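(* For $n\ge3$, $$\widetilde B_n(t)=\widetilde D_n(t)+2nt\,D_{n-1}(t).$$
   Context: $B_n$ is the group of signed permutations: permutations $w$ of $\{\pm1,\dots,\pm n\}$ with $w(-i)=-w(i)$, written $w=w_1\cdots w_n$ with $w_i=w(i)$. $D_n$ ($n\ge2$) is the subgroup of those $w$ with an even number of negative entries among $w_1,\dots,w_n$. Type $B$: the number of affine descents of $w\in B_n$ is $\widetilde d_B(w)=|\{i\in\{1,\dots,n\}:w_{i-1}>w_i\}|$ (with $w_0=0$), plus $1$ if $w_{n-1}+w_n>0$; $\widetilde B_n(t)=\sum_{w\in B_n}t^{\widetilde d_B(w)}$. Type $D$: the number of ordinary descents of $w\in D_n$ is $d_D(w)=|\{i\in\{2,\dots,n\}:w_{i-1}>w_i\}|$, plus $1$ if $w_1+w_2<0$; the number of affine descents (for $n\ge3$) is $\widetilde d_D(w)=d_D(w)$, plus $1$ if $w_{n-1}+w_n>0$. Then $D_n(t)=\sum_{w\in D_n}t^{d_D(w)}$ for $n\ge2$ (in particular $D_2(t)=(1+t)^2$) and $\widetilde D_n(t)=\sum_{w\in D_n}t^{\widetilde d_D(w)}$ for $n\ge3$. *)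

(* Defs.v *)
From mathcomp Require Import all_boot all_order all_algebra all_fingroup.

Set Implicit Arguments.
Unset Strict Implicit.
Unset Printing Implicit Defensive.

Import Order.TTheory GRing.Theory Num.Theory.
Local Open Scope ring_scope.

(* The set {±1, ..., ±n}: the pair (i, b), with i ranging over 0, ..., n-1,   *)
(* stands for the integer i+1 if b = false and for -(i+1) if b = true.        *)
Definition signed (n : nat) : finType := ('I_n * bool)%type.

Definition signed_val n (x : signed n) : int :=
  if x.2 then - (x.1.+1)%:Z else (x.1.+1)%:Z.

Definition signed_opp n (x : signed n) : signed n := (x.1, ~~ x.2).

Definition signed_perms (n : nat) : {set {perm (signed n)}} :=
  [set w : {perm (signed n)} | [forall x, w (signed_opp x) == signed_opp (w x)]].

(* w_i = w(i) for 1 <= i <= n, and w_0 = 0 (junk value 0 for i > n).          *)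
Definition letter n (w : {perm (signed n)}) (i : nat) : int :=
  if i is j.+1 then
    if insub j is Some k then signed_val (w (k, false)) else 0
  else 0.

Definition even_signed_perms (n : nat) : {set {perm (signed n)}} :=
  [set w in signed_perms n | ~~ odd #|[set i : 'I_n | letter w i.+1 < 0]|].

Definition affine_desB n (w : {perm (signed n)}) : nat :=
  (\sum_(1 <= i < n.+1) (letter w i.-1 > letter w i)%R
   + (letter w n.-1 + letter w n > 0)%R)%N.

Definition desD n (w : {perm (signed n)}) : nat :=
  (\sum_(2 <= i < n.+1) (letter w i.-1 > letter w i)%R
   + (letter w 1 + letter w 2 < 0)%R)%N.

Definition affine_desD n (w : {perm (signed n)}) : nat :=
  (desD w + (letter w n.-1 + letter w n > 0)%R)%N.

Definition affine_polyB (n : nat) : {poly int} :=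
  \sum_(w in signed_perms n) 'X^(affine_desB w).

Definition polyD (n : nat) : {poly int} :=
  \sum_(w in even_signed_perms n) 'X^(desD w).

Definition affine_polyD (n : nat) : {poly int} :=
  \sum_(w in even_signed_perms n) 'X^(affine_desD w).

(* Main.v *)
Require Import Defs.
From mathcomp Require Import all_boot all_order all_algebra all_fingroup.
From mathcomp Require Import zify ring.

(* Let w' be w with the sign of its first letter changed, and let r(w) count
   the affine descents of w that do not involve w_1. Since the type D affine
   descents are invariant under w -> w', comparing the signs of w_1 and of
   w_1 +/- w_2 gives t^dB(w) + t^dB(w') = t^dD(w) + t * t^r(w). Deleting w_1
   (2n choices), standardizing the rest, reversing it and negating it turns r
   into the ordinary type D descent number on B_{n-1}. Sums over B_n of
   statistics invariant under w -> w' are twice the sums over D_n, so the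
   identity, multiplied by 2, follows by summing over B_n. *)

Import Order.TTheory GRing.Theory Num.Theory.
Local Open Scope ring_scope.

#[local] Arguments letter : simpl never.

(** * Signed permutations and their letters *)

Lemma signed_permsP {n} {w : {perm signed n}} :
  reflect (forall x, w (signed_opp x) = signed_opp (w x)) (w \in signed_perms n).
Proof. by rewrite inE; apply: (iffP forallP) => H x; apply/eqP. Qed.

Lemma signed_valN n (x : signed n) : signed_val (signed_opp x) = - signed_val x.
Proof. by case: x => i []; rewrite /signed_val /= ?opprK. Qed.

Lemma signed_val_neq0 n (x : signed n) : signed_val x != 0.
Proof. by case: x => i []; rewrite /signed_val /= ?oppr_eq0. Qed.

Lemma signed_val_inj n : injective (@signed_val n).
Proof.
by move=> [i b] [j c]; rewrite /signed_val /=; case: b c => [] [] E;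
  first [exfalso; lia | congr (_, _); apply: val_inj; rewrite /=; lia].
Qed.

Lemma letterS n (w : {perm signed n}) j (hj : (j < n)%N) :
  letter w j.+1 = signed_val (w (Ordinal hj, false)).
Proof. by rewrite /letter insubT. Qed.

(** * Changing the sign of the first letter *)

(** Products of permutations apply the left factor first, so the transposition acts on positions,
    not on values. *)
Definition flip_first n (w : {perm signed n.+1}) : {perm signed n.+1} :=
  (tperm (ord0, false) (ord0, true) * w)%g.

Lemma flip_firstK n : involutive (flip_first n).
Proof. by move=> w; rewrite /flip_first mulgA tperm2 mul1g. Qed.

Lemma flip_first_signed n (w : {perm signed n.+1}) :
  (flip_first n w \in signed_perms n.+1) = (w \in signed_perms n.+1).
Proof.
have imp u : u \in signed_perms n.+1 -> flip_first n u \in signed_perms n.+1.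
  move=> /signed_permsP uN; apply/signed_permsP => x.
  rewrite !permM -uN; congr (u _); case: x => i b.
  have [->|i0] := eqVneq i ord0; last first.
    by rewrite !tpermD // /signed_opp /= -pair_eqE /= eq_sym (negPf i0).
  by case: b; rewrite /signed_opp /= ?tpermL ?tpermR.
by apply/idP/idP => [/imp|/imp //]; rewrite flip_firstK.
Qed.

Lemma letter_flip1 n (w : {perm signed n.+1}) :
  w \in signed_perms n.+1 -> letter (flip_first n w) 1 = - letter w 1.
Proof.
move=> /signed_permsP wN.
rewrite !(letterS _ _ 0%N (ltn0Sn n)) permM.
have -> : Ordinal (ltn0Sn n) = ord0 by apply: val_inj.
by rewrite tpermL -signed_valN -wN.
Qed.

Lemma letter_flipS n (w : {perm signed n.+1}) i :
  (i != 1)%N -> letter (flip_first n w) i = letter w i.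
Proof.
case: i => [|j] // j0; rewrite /letter; case: insubP => // k _ kj.
by rewrite permM tpermD // -pair_eqE /= -val_eqE /= kj eq_sym andbC //= andbC; apply/nandP; left.
Qed.

Lemma letter1_neq0 n (w : {perm signed n.+1}) : letter w 1 != 0.
Proof. by rewrite (letterS _ _ 0%N (ltn0Sn n)) signed_val_neq0. Qed.

(** Only the first letter changes sign, and it is nonzero, so the number of negative letters changes
    by exactly one. *)
Lemma odd_flip n (w : {perm signed n.+1}) : w \in signed_perms n.+1 ->
  odd #|[set i : 'I_n.+1 | letter (flip_first n w) i.+1 < 0]|
  = ~~ odd #|[set i : 'I_n.+1 | letter w i.+1 < 0]|.
Proof.
move=> wB; rewrite (cardsD1 ord0) [in RHS](cardsD1 ord0) !oddD !inE.
rewrite letter_flip1 // oppr_lt0.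
set A := (_ :\ _); set A' := (_ :\ _).
have -> : A = A'.
  apply/setP => i; rewrite !inE; case: eqVneq => //= i0.
  by rewrite letter_flipS.
have -> : letter w (ord0 : 'I_n.+1).+1 = letter w 1 by [].
by have := letter1_neq0 _ w; case: (ltgtP (letter w 1) 0) => //= _ _; case: (odd _).
Qed.

Lemma mem_even_signed_perms n (w : {perm signed n}) :
  (w \in even_signed_perms n)
  = (w \in signed_perms n) && ~~ odd #|[set i : 'I_n | letter w i.+1 < 0]|.
Proof. by rewrite [LHS]in_set. Qed.

Lemma sum_flip_invariant n (F : {perm signed n.+1} -> {poly int}) :
  {in signed_perms n.+1, forall w, F (flip_first n w) = F w} ->
  \sum_(w in signed_perms n.+1) F w
  = 2%:R * \sum_(w in even_signed_perms n.+1) F w.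
Proof.
move=> Fflip.
rewrite (bigID (mem (even_signed_perms n.+1))) /= mulr_natl mulr2n; congr (_ + _).
  by apply: eq_bigl => w; rewrite mem_even_signed_perms andbA andbb.
(* [flip_first] carries the even half of the group onto the odd half. *)
rewrite (reindex_inj (can_inj (flip_firstK n))) /=.
have E w : (flip_first n w \in signed_perms n.+1)
    && (flip_first n w \notin even_signed_perms n.+1)
    = (w \in even_signed_perms n.+1).
  rewrite !mem_even_signed_perms flip_first_signed.
  case: (boolP (w \in signed_perms n.+1)) => //= wB.
  by rewrite odd_flip // negbK.
rewrite (eq_bigl _ _ E); apply: eq_bigr => w.
by rewrite mem_even_signed_perms => /andP[/Fflip].
Qed.

(** * Descents that involve the first letter, and the others *)

(** The statistic r. The sum starts at 3 because the descents at 1 and 2 involve the first letter;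
    the last term avoids it once [3 <= n]. *)
Definition tail_des n (w : {perm signed n}) : nat :=
  (\sum_(3 <= i < n.+1) (letter w i.-1 > letter w i)%R
   + (letter w n.-1 + letter w n > 0)%R)%N.

Lemma tail_des_flip n (w : {perm signed n.+1}) : (2 <= n)%N ->
  tail_des n.+1 (flip_first n w) = tail_des n.+1 w.
Proof.
move=> n2; rewrite /tail_des !letter_flipS /=; try lia.
congr (_ + _)%N; apply: eq_big_nat => i /andP[i3 _].
by rewrite !letter_flipS; lia.
Qed.

Lemma affine_desB_tail n (w : {perm signed n}) : (3 <= n)%N ->
  affine_desB w = ((letter w 1 < 0)%R + (letter w 2 < letter w 1)%R + tail_des n w)%N.
Proof.
move=> n3; rewrite /affine_desB /tail_des.
by rewrite (@big_ltn _ _ _ 1%N) ?(@big_ltn _ _ _ 2%N) /= ?addnA //; lia.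
Qed.

Lemma affine_desD_tail n (w : {perm signed n}) : (3 <= n)%N ->
  affine_desD w
  = ((letter w 1 + letter w 2 < 0)%R + (letter w 2 < letter w 1)%R + tail_des n w)%N.
Proof.
by move=> n3; rewrite /affine_desD /desD /tail_des (@big_ltn _ _ _ 2%N) /=; lia.
Qed.

(** The conditions w_1 > w_2 and -w_1 > w_2 are exchanged, and all other terms are unchanged. *)
Lemma desD_flip n (w : {perm signed n.+1}) : (1 <= n)%N ->
  w \in signed_perms n.+1 -> desD (flip_first n w) = desD w.
Proof.
move=> n1 wB; rewrite /desD !(@big_ltn _ _ _ 2%N) //= letter_flip1 //.
rewrite (letter_flipS _ _ 2%N) //.
have -> : (\sum_(3 <= i < n.+2) (letter (flip_first n w) i < letter (flip_first n w) i.-1)%R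
  = \sum_(3 <= i < n.+2) (letter w i < letter w i.-1)%R)%N.
  by apply: eq_big_nat => i /andP[i3 _]; rewrite !letter_flipS; lia.
lia.
Qed.

Lemma affine_desD_flip n (w : {perm signed n.+1}) : (2 <= n)%N ->
  w \in signed_perms n.+1 -> affine_desD (flip_first n w) = affine_desD w.
Proof.
by move=> n2 wB; rewrite /affine_desD desD_flip ?(ltnW n2) // !letter_flipS //=; lia.
Qed.

Lemma letter12_neq n (w : {perm signed n}) : (2 <= n)%N -> w \in signed_perms n ->
  letter w 1 != letter w 2 /\ letter w 1 != - letter w 2.
Proof.
move=> n2 /signed_permsP wN.
rewrite (letterS _ _ 0%N (ltnW n2)) (letterS _ _ 1%N n2) -signed_valN -wN.
by rewrite !(inj_eq (signed_val_inj n)) !(inj_eq perm_inj).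
Qed.

Lemma flip_pair n (w : {perm signed n.+1}) : (2 <= n)%N -> w \in signed_perms n.+1 ->
  'X^(affine_desB w) + 'X^(affine_desB (flip_first n w))
  = 'X^(affine_desD w) + 'X * 'X^(tail_des n.+1 w) :> {poly int}.
Proof.
move=> n2 wB.
rewrite !affine_desB_tail // affine_desD_tail // tail_des_flip //.
rewrite letter_flip1 // (letter_flipS _ _ 2%N) //.
have [ne1 ne2] := letter12_neq _ _ (leqW n2) wB.
have ne0 := letter1_neq0 _ w.
rewrite oppr_lt0.
move: (tail_des _ _) (letter w 1) (letter w 2) ne0 ne1 ne2 => k a b a0 ab aNb.
have -> : (b < - a) = (a + b < 0) by lia.
rewrite !exprD.
(* Up to the factor t^k, both sides are 1 + t if b > |a|, 2t if |b| < |a|, and t + t^2 if b <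
   -|a|. *)
case: (ltgtP a 0) a0 => // a0 _; case: (ltP b a) => ba; case: (ltP (a + b) 0) => s /=;
  try (exfalso; lia); rewrite !(expr0, expr1); ring.
Qed.

(** * Deleting and inserting a first letter *)

Definition signed_lift n (a : 'I_n.+1) (y : signed n) : signed n.+1 := (lift a y.1, y.2).

Lemma signed_lift_inj n (a : 'I_n.+1) : injective (signed_lift n a).
Proof.
by move=> [i b] [j c] E; have [/= /lift_inj-> ->] := (congr1 fst E, congr1 snd E).
Qed.

(** Signs are kept, and [lift] preserves the order of absolute values. Hence [signed_lift] undoes
    standardization. *)
Lemma signed_val_lift_lt n (a : 'I_n.+1) (y z : signed n) :
  (signed_val (signed_lift n a y) < signed_val (signed_lift n a z))
  = (signed_val y < signed_val z).
Proof.
case: y z => [i b] [j c]; rewrite /signed_val /=.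
have := leq_bump2 a i j; have := leq_bump2 a j i.
by case: b; case: c; lia.
Qed.

(* The word of [insert_fun x v] is [x] followed by the negated reversal of the
   word of [v], relabelled order-preservingly by the letters other than [x]. *)
Definition insert_fun n (x : signed n.+1) (v : {perm signed n}) (p : signed n.+1) :
  signed n.+1 :=
  if unlift ord0 p.1 is Some j then signed_lift n x.1 (v (rev_ord j, ~~ p.2))
  else (x.1, x.2 (+) p.2).

Lemma insert_fun_inj n x v : injective (insert_fun n x v).
Proof.
move=> [i b] [j c]; rewrite /insert_fun /=.
case: (unliftP ord0 i) => [i' ->|->]; case: (unliftP ord0 j) => [j' ->|->].
- by move/signed_lift_inj/perm_inj => /eqP; rewrite xpair_eqE => /andP[/eqP/rev_ord_inj-> /eqP/negb_inj->].
- by move=> /(congr1 fst)/eqP; rewrite eq_sym (negPf (neq_lift _ _)).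
- by move=> /(congr1 fst)/eqP; rewrite (negPf (neq_lift _ _)).
- by move=> /(congr1 snd)/addbI->.
Qed.

Definition insert_first n (xv : signed n.+1 * {perm signed n}) : {perm signed n.+1} :=
  perm (insert_fun_inj n xv.1 xv.2).

Lemma insert_first0 n x v b : insert_first n (x, v) (ord0, b) = (x.1, x.2 (+) b).
Proof. by rewrite permE /insert_fun /= unlift_none. Qed.

Lemma insert_first_lift n x v j b :
  insert_first n (x, v) (lift ord0 j, b) = signed_lift n x.1 (v (rev_ord j, ~~ b)).
Proof. by rewrite permE /insert_fun /= liftK. Qed.

Lemma insert_first_inj n : injective (insert_first n).
Proof.
move=> [x v] [y u] /permP E.
have xy : x = y.
  have := E (ord0, false); rewrite !insert_first0 !addbF.
  by case: x y {E} => [? ?] [? ?].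
rewrite -{y}xy in E *; congr (_, _); apply/permP => -[j b].
have := E (lift ord0 (rev_ord j), ~~ b).
by rewrite !insert_first_lift rev_ordK negbK => /signed_lift_inj.
Qed.

Lemma insert_first_signed n x v :
  v \in signed_perms n -> insert_first n (x, v) \in signed_perms n.+1.
Proof.
move=> /signed_permsP vN; apply/signed_permsP => -[i b].
rewrite /signed_opp /=; case: (unliftP ord0 i) => [j ->|->].
  by rewrite !insert_first_lift (vN (rev_ord j, ~~ b)).
by rewrite !insert_first0 /= addbN.
Qed.

(** By injectivity, the letters after the first one x avoid both x and -x, so they can be pulled
    back along [signed_lift]. *)
Lemma insert_first_surj n (w : {perm signed n.+1}) : w \in signed_perms n.+1 ->
  exists2 xv, xv.2 \in signed_perms n & w = insert_first n xv.
Proof.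
move=> /signed_permsP wN; pose x := w (ord0, false).
have w0 b : w (ord0, b) = (x.1, x.2 (+) b).
  case: b; last by rewrite addbF -surjective_pairing.
  by rewrite (wN (ord0, false)) addbT.
have wl p : {y | w (lift ord0 (rev_ord p.1), ~~ p.2) = signed_lift n x.1 y}.
  set q := w _; case: (unliftP x.1 q.1) => [k|] Eq.
    by exists (k, q.2); rewrite /signed_lift /= -Eq -surjective_pairing.
  (* A value with the absolute value of x is already taken at position 1 or -1. *)
  have : q = w (ord0, x.2 (+) q.2).
    by rewrite w0 addbA addbb -Eq -surjective_pairing.
  by move/perm_inj/(congr1 fst)/eqP; rewrite eq_sym (negPf (neq_lift _ _)).
pose f p := sval (wl p).
have fE p : w (lift ord0 (rev_ord p.1), ~~ p.2) = signed_lift n x.1 (f p).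
  exact: (svalP (wl p)).
have f_inj : injective f.
  move=> [i b] [j c] E; have := fE (i, b); rewrite E -fE.
  by move/perm_inj/eqP; rewrite xpair_eqE /= => /andP[/eqP/lift_inj/rev_ord_inj-> /eqP/negb_inj->].
have vE p : signed_lift n x.1 (perm f_inj p) = w (lift ord0 (rev_ord p.1), ~~ p.2).
  by rewrite permE fE.
exists (x, perm f_inj).
  apply/signed_permsP => p; apply: (signed_lift_inj n x.1).
  by rewrite vE /= (wN (_, ~~ p.2)) -vE.
apply/permP => -[i b]; case: (unliftP ord0 i) => [j ->|->].
  by rewrite insert_first_lift vE /= rev_ordK negbK.
by rewrite insert_first0.
Qed.

(** The index i counts the letters of v from 0: the last letter of the new word comes from the first
    letter of v. *)
Lemma letter_insert n x (v : {perm signed n}) i (hi : (i < n)%N) :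
  v \in signed_perms n ->
  letter (insert_first n (x, v)) (n.+1 - i)
  = - signed_val (signed_lift n x.1 (v (Ordinal hi, false))).
Proof.
move=> /signed_permsP vN.
have hj : (n - i < n.+1)%N by lia.
rewrite subSn ?(ltnW hi) // (letterS _ _ _ hj).
have -> : Ordinal hj = lift ord0 (rev_ord (Ordinal hi)).
  by apply: val_inj; rewrite /= /bump /=; lia.
by rewrite insert_first_lift rev_ordK (vN (_, false)) -signed_valN.
Qed.

(** Reversal and negation each exchange ascents and descents, so together they preserve descents.
    The final affine condition becomes v_1 + v_2 < 0. *)
Lemma tail_des_insert n x (v : {perm signed n}) : (2 <= n)%N ->
  v \in signed_perms n -> tail_des n.+1 (insert_first n (x, v)) = desD v.
Proof.
move=> n2 vB; have /signed_permsP vN := vB.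
rewrite /tail_des /desD; congr (_ + _)%N.
  (* The comparison of v_{i-1} with v_i matches the one at positions n+2-i and n+3-i. *)
  rewrite big_add1 big_nat_rev /=; apply: eq_big_nat => i /andP[i2 iN].
  have h1 : (i.-2 < n)%N by lia.
  have h2 : (i.-1 < n)%N by lia.
  have -> : (2 + n.+1 - i.+1)%N = (n.+1 - i.-1)%N by lia.
  have -> : (n.+1 - i.-1).+1 = (n.+1 - i.-2)%N by lia.
  rewrite (letter_insert _ _ _ _ h1) // (letter_insert _ _ _ _ h2) //.
  rewrite ltrN2 signed_val_lift_lt.
  have -> : letter v i.-1 = letter v i.-2.+1 by congr letter; lia.
  have -> : letter v i = letter v i.-1.+1 by congr letter; lia.
  by rewrite (letterS _ _ _ h1) (letterS _ _ _ h2).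
have h0 : (0 < n)%N by lia.
rewrite /= (letterS _ _ _ h0) (letterS _ _ _ n2).
have := letter_insert _ x _ _ h0 vB; rewrite subn0 => ->.
have := letter_insert _ x _ _ n2 vB; rewrite subn1 /= => ->.
set p := v _; set q := v _.
(* Relabelling need not preserve sums, but p + q < 0 means q < -p, an order comparison that it does
   preserve. *)
have := signed_val_lift_lt _ x.1 q (signed_opp p).
have -> : signed_lift n x.1 (signed_opp p) = signed_opp (signed_lift n x.1 p) by [].
rewrite !signed_valN; move: (signed_val p) (signed_val q) => a b.
by move: (signed_val _) (signed_val _) => c d; lia.
Qed.

(** * Summation over the group *)

(** The factor counts the inserted letters x, on which the exponent does not depend. *)
Lemma sum_tail_des n : (2 <= n)%N ->
  \sum_(w in signed_perms n.+1) 'X^(tail_des n.+1 w)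
  = (2 * n.+1)%:R * \sum_(v in signed_perms n) 'X^(desD v) :> {poly int}.
Proof.
move=> n2.
have -> : signed_perms n.+1 = insert_first n @: setX [set: signed n.+1] (signed_perms n).
  apply/setP => w; apply/idP/imsetP => [/insert_first_surj[[x v] vB ->]|[[x v]]].
    by exists (x, v); rewrite // in_setX in_setT.
  by rewrite in_setX => /andP[_ vB] ->; apply: insert_first_signed.
rewrite big_imset /=; last by move=> ? ? _ _; apply: insert_first_inj.
rewrite (eq_bigl (fun xv => xpredT xv.1 && (xv.2 \in signed_perms n))); last first.
  by case=> x v; rewrite in_setX in_setT.
rewrite -(pair_big xpredT (mem (signed_perms n))
  (fun x v => 'X^(tail_des n.+1 (insert_first n (x, v))))) /=.
rewrite (eq_bigr (fun=> \sum_(v in signed_perms n) 'X^(desD v))).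
  by rewrite sumr_const card_prod card_ord card_bool mulnC mulr_natl.
by move=> x _; apply: eq_bigr => v vB; rewrite tail_des_insert.
Qed.

Theorem proposition6p2 (n : nat) (hn : (3 <= n)%N) :
  affine_polyB n = affine_polyD n + (2 * n)%:R * 'X * polyD n.-1.
Proof.
case: n hn => [|[|n]] // n2; rewrite ltnS in n2.
have two0 : (2%:R : {poly int}) != 0 by rewrite -polyC_natr polyC_eq0.
apply: (mulfI two0).
have -> : 2%:R * affine_polyB n.+2 = \sum_(w in signed_perms n.+2)
    ('X^(affine_desB w) + 'X^(affine_desB (flip_first n.+1 w))).
  rewrite big_split /= mulr_natl mulr2n /affine_polyB; congr (_ + _).
  (* The second copy of the sum is reindexed by the sign change. *)
  rewrite (reindex_inj (can_inj (flip_firstK n.+1))) /=.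
  by apply: eq_bigl => w; rewrite flip_first_signed.
rewrite (eq_bigr _ (fun w => flip_pair n.+1 w n2)) big_split /= -mulr_sumr.
(* Passing from B to D yields a factor 2 in both sums, matching the 2 on the left. *)
rewrite sum_tail_des // !sum_flip_invariant.
- by rewrite -/(affine_polyD n.+2) -/(polyD n.+1); ring.
- by move=> w wB; rewrite desD_flip.
- by move=> w wB; rewrite affine_desD_flip.
Qed.
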